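(* Let $D$ be a prime, $n\ge 1$, and let $\mathcal{S}=\langle g_1,\dots,g_m\rangle$ be an $n$-qudit stabilizer group with generating set $G=\{g_1,\dots,g_m\}$. After a measurement of an $n$-qudit Pauli observable $P\in\mathcal{P}_D^{\otimes n}$ with outcome $o\in[D]$, the stabilizer group $\mathcal{S}$ is updated to a stabilizer group $\mathcal{S}'$ according to the following rules. 1. If $\omega^aP\in\mathcal{S}$ for some $a\in[D]$, then $\mathcal{S}'=\mathcal{S}$, i.e. the stabilizer stays the same. In this case, the outcome $o$ is deterministic. 2. If $\omega^aP\notin\mathcal{S}$ for all $a\in[D]$ but $P$ commutes with all $s\in\mathcal{S}$, then $\mathcal{S}'=\langle\omega^{-o}P,g_1,\dots,g_m\rangle$, i.e. $\omega^{-o}P$ is simply added to the set of generators. 3. If $P$ does not commute with each element in a subset $W=\{g_1,\dots,g_l\}$ (for $l\le m$) of the generator set $G$, then $\mathcal{S}'=\langle W',\omega^{-o}P,G\setminus W\rangle$. Here $W'$ is a set of $l-1$ stabilizers from $\mathcal{S}$ such that $\mathcal{S}=\langle W',g^*,G\setminus W\rangle$ for some arbitrarily chosen $g^*\in W$. Namely, the generator $g^*$ is replaced with $\omega^{-o}P$, the rest of $W$ is replaced with $W'$, and the generators that commute with $P$ (those in $G\setminus W$) are kept.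
   Context: Let $\omega=e^{2\pi i/D}$ and $[D]=\{0,\dots,D-1\}$; exponents are taken mod $D$. On $\mathbb{C}^D$ with orthonormal basis $|0\rangle,\dots,|D-1\rangle$ let $X=\sum_j|j+1 \bmod D\rangle\langle j|$ and $Z=\sum_j\omega^j|j\rangle\langle j|$. The qudit Pauli group is $\mathcal{P}_D=\{\omega^lX^aZ^b:a,b,l\in[D]\}$, and $\mathcal{P}_D^{\otimes n}$ is the $n$-qudit Pauli group, acting on $(\mathbb{C}^D)^{\otimes n}$. An $n$-qudit stabilizer group $\mathcal{S}$ is an abelian subgroup of $\mathcal{P}_D^{\otimes n}$ (understood to contain no scalar $\omega^aI$ with $a\ne0$); its elements are called stabilizers, and $\langle\cdots\rangle$ denotes the group generated by the listed elements. Its stabilizer code is $\mathcal{C}(\mathcal{S})=\{|\psi\rangle: s|\psi\rangle=|\psi\rangle\ \forall s\in\mathcal{S}\}$. Measuring an $n$-qudit Pauli $P$ (understood to satisfy $P^D=I$) means performing the projective measurement onto its eigenspaces: outcome $o\in[D]$ corresponds to eigenvalue $\omega^o$, with projector $\Pi_o^{(P)}=\frac1D\sum_{j=0}^{D-1}(\omega^{-o}P)^j$, and the post-measurement state of $|\psi\rangle$ is $\Pi_o^{(P)}|\psi\rangle$ up to normalization. That $\mathcal{S}$ is updated to $\mathcal{S}'$ after measuring $P$ with outcome $o$ means that, for an outcome $o$ that can occur, a state is in $\mathcal{C}(\mathcal{S}')$ if and only if it is the post-measurement state of some state in $\mathcal{C}(\mathcal{S})$. That the outcome is deterministic means that the same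 outcome occurs with probability $1$ for every state in $\mathcal{C}(\mathcal{S})$. *)

(* Defs.v *)
From mathcomp Require Import all_boot all_order all_algebra.
From mathcomp Require Import complex.
From mathcomp Require Import all_classical all_reals all_analysis.

Set Implicit Arguments.
Unset Strict Implicit.
Unset Printing Implicit Defensive.

Import Order.TTheory GRing.Theory Num.Theory.

Local Open Scope classical_set_scope.
Local Open Scope ring_scope.
Local Open Scope complex_scope.

(* (C^D)^{(x) n} is C^N with N = hdim D n: its computational basis
   |x_1 ... x_n> is indexed by the words x : {ffun 'I_n -> 'I_D}, numbered
   through enum_rank / enum_val. *)
Notation hdim D n := #|{ffun 'I_n -> 'I_D}|.

Section Qudits.
Variables (R : realType) (D n : nat).
Local Notation C := (R[i]).
Local Notation vec := 'cV[C]_(hdim D n).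
Local Notation oper := 'M[C]_(hdim D n).

Definition omega : C := cos (2 * pi / D%:R) +i* sin (2 * pi / D%:R).

(* The entry (i, j) of a matrix is <i|M|j>; ordS j is j + 1 mod D. *)
Definition pauliX : 'M[C]_D := \matrix_(i, j) (i == ordS j)%:R.
Definition pauliZ : 'M[C]_D := diag_mx (\row_j omega ^+ j).

Definition pauli1 (M : 'M[C]_D) : Prop :=
  exists l a b : 'I_D, M = omega ^+ l *: (pauliX ^+ a *m pauliZ ^+ b).

(* <x| A_1 (x) ... (x) A_n |y> = \prod_k <x_k| A_k |y_k> *)
Definition tensor (A : 'I_n -> 'M[C]_D) : oper :=
  \matrix_(i, j) \prod_(k < n)
    A k ((enum_val i : {ffun 'I_n -> 'I_D}) k)
        ((enum_val j : {ffun 'I_n -> 'I_D}) k).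

Definition pauli (M : oper) : Prop :=
  exists2 A : 'I_n -> 'M[C]_D, (forall k, pauli1 (A k)) & M = tensor A.

Definition is_subgroup (S : set oper) : Prop :=
  [/\ S 1%:M, forall s t, S s -> S t -> S (s *m t)
    & forall s, S s -> S (invmx s)].

Definition generated (A : set oper) : set oper := smallest is_subgroup A.

Definition stabilizer_group (S : set oper) : Prop :=
  [/\ S `<=` pauli, is_subgroup S,
      forall s t, S s -> S t -> s *m t = t *m s
    & forall a : 'I_D, S (omega ^+ a)%:M -> a = 0%N :> nat].

Definition code (S : set oper) : set vec :=
  [set psi | forall s, S s -> s *m psi = psi].

Definition sqnorm (psi : vec) : C := \sum_i `|psi i 0| ^+ 2.

Definition state (psi : vec) : Prop := sqnorm psi = 1.

Definition meas_proj (P : oper) (o : 'I_D) : oper :=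
  D%:R^-1 *: \sum_(j < D) (omega ^- o *: P) ^+ j.

Definition outcome_prob (P : oper) (o : 'I_D) (psi : vec) : C :=
  sqnorm (meas_proj P o *m psi).

Definition post_state (P : oper) (o : 'I_D) (psi phi : vec) : Prop :=
  outcome_prob P o psi != 0 /\
  phi = (sqrtC (outcome_prob P o psi))^-1 *: (meas_proj P o *m psi).

Definition can_occur (S : set oper) (P : oper) (o : 'I_D) : Prop :=
  exists psi, [/\ state psi, code S psi & outcome_prob P o psi != 0].

Definition updated (S : set oper) (P : oper) (o : 'I_D) (S' : set oper) : Prop :=
  stabilizer_group S' /\
  (can_occur S P o -> forall phi, state phi ->
     (code S' phi <->
      exists psi, [/\ state psi, code S psi & post_state P o psi phi])).

Definition deterministic (S : set oper) (P : oper) : Prop :=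
  exists o : 'I_D, forall psi, state psi -> code S psi ->
    outcome_prob P o psi = 1.

End Qudits.

(* Main.v *)
(* Up to a phase, a Pauli operator is a tensor product of operators X^a Z^b, so two
   Paulis commute up to a power of omega, and the D-th power of a Pauli is a
   power of omega; hence s^D = 1 for every stabilizer s.
   Write Q = omega^-o P.  As D is prime, if no omega^a P lies in S, then the
   elements Q^k s, with s in S commuting with P, form a stabilizer group.
   When P commutes with S, a state fixed by S and Q is its own
   post-measurement state.  When P g = omega^c g P with omega^c <> 1, a state
   phi fixed by Q and by the generators commuting with P is, up to
   normalization, the projection of sum_(j < D) g^j phi: the vector g^j phi is
   an eigenvector of Q for omega^(c j), which the projector kills unless j = 0.
   The generators g' that do not commute with P are replaced by products
   g' g^k that do. *)
Require Import Defs.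
From mathcomp Require Import all_boot all_order all_algebra.
From mathcomp Require Import complex.
From mathcomp Require Import all_classical all_reals all_analysis.
From mathcomp Require Import ring.

Import Order.TTheory GRing.Theory Num.Theory.

Local Open Scope classical_set_scope.
Local Open Scope ring_scope.
Local Open Scope complex_scope.

(** * Powers of scaled matrices, and [omega] as a primitive root of unity *)

Lemma expr_scalemx (F : comPzRingType) (N j : nat) (c : F) (M : 'M[F]_N) :
  (c *: M) ^+ j = c ^+ j *: M ^+ j.
Proof.
elim: j => [|j IHj]; first by rewrite !expr0 scale1r.
by rewrite !exprS IHj -!mulmxE -scalemxAl -scalemxAr scalerA.
Qed.

Lemma omegaX (R : realType) (D k : nat) :
  omega R D ^+ k = cos (k%:R * (2 * pi / D%:R)) +i* sin (k%:R * (2 * pi / D%:R)).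
Proof.
elim: k => [|k IHk]; first by rewrite expr0 mul0r cos0 sin0.
rewrite exprSr IHk /omega -(addn1 k) (natrD _ k 1) (mulrDl k%:R) mul1r cosD sinD.
by apply/eqP; rewrite eq_complex /= eqxx addrC eqxx.
Qed.

(** The order of [omega] divides the prime [D], so it is 1 or [D]. It is not 1: 0 < 2 pi / D <= pi,
    and the cosine decreases strictly on [0, pi]. *)
Lemma omega_prim (R : realType) (D : nat) :
  prime D -> D.-primitive_root (omega R D).
Proof.
move=> pD; have D2 := prime_gt1 pD.
have wD : omega R D ^+ D = 1.
  rewrite omegaX mulrC divfK ?pnatr_eq0 -?lt0n ?prime_gt0 //.
  by rewrite mulr_natl cos2pi sin2pi.
have [m pm mD] := prim_order_exists (prime_gt0 pD) wD.
have /orP[/eqP m1|/eqP mE] := (primeP pD).2 _ mD.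
  2: by rewrite -{1}mE.
have : omega R D = 1 by rewrite -(prim_expr_order pm) m1.
case=> /eqP; rewrite lt_eqF // -[ltRHS]cos0.
have pi0 := pi_gt0 R; have D0 : 0 < D%:R :> R by rewrite ltr0n prime_gt0.
have x0 : 0 < 2 * pi / D%:R :> R by rewrite divr_gt0 ?mulr_gt0.
rewrite ltr_cos ?in_itv /= ?lexx ?(ltW pi0) ?(ltW x0) //=.
by rewrite ler_pdivrMr // mulrC ler_pM2l // ler_nat.
Qed.

(** * Pauli operators in Weyl form: a phase times a tensor product of X^a Z^b *)

Section WeylOperators.
Variables (R : realType) (D n : nat).
Hypothesis pD : prime D.
Local Notation C := (R[i]).
Local Notation w := (omega R D).
Local Notation X := (pauliX R D).
Local Notation Z := (pauliZ R D).

Let wP : D.-primitive_root w. Proof. exact: omega_prim. Qed.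

Lemma omega_neq0 : w != 0.
Proof. by rewrite -unitfE -(unitrX_pos _ (prime_gt0 pD)) prim_expr_order ?unitr1. Qed.

(** Turns inverse phases into the natural powers in which the Pauli group is stated. *)
Lemma omega_inv (k : nat) : exists a : 'I_D, w ^- k = w ^+ a.
Proof.
(* [D.-1] plays the role of -1 modulo [D]. *)
exists (Ordinal (ltn_pmod (k * D.-1) (prime_gt0 pD))) => /=.
apply: (mulfI (expf_neq0 k omega_neq0)).
rewrite divff ?expf_neq0 ?omega_neq0 // (prim_expr_mod wP) -exprD -mulnS prednK ?prime_gt0 //.
by rewrite mulnC exprM (prim_expr_order wP) expr1n.
Qed.

Lemma pauliXXE k (i j : 'I_D) : (X ^+ k) i j = (i == (j + k) %% D :> nat)%N%:R.
Proof.
elim: k i j => [|k IHk] i j; first by rewrite expr0 mxE addn0 modn_small.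
rewrite exprS mxE (bigD1 (Ordinal (ltn_pmod (j + k) (prime_gt0 pD)))) //=.
rewrite IHk eqxx mulr1 mxE big1 ?addr0 => [|l ne_l].
  by rewrite -val_eqE /= -(addn1 (_ %% _)) modnDml addn1 addnS.
by rewrite IHk -(inj_eq val_inj) in ne_l *; rewrite (negbTE ne_l) mulr0.
Qed.

Lemma pauliZXE k : Z ^+ k = diag_mx (\row_j w ^+ (j * k)%N).
Proof.
elim: k => [|k IHk].
  by apply/matrixP => i j; rewrite !mxE muln0.
rewrite exprS IHk [LHS]mulmx_diag; congr diag_mx; apply/rowP => j.
by rewrite !mxE -exprD mulnS.
Qed.

Lemma pauliX_order : X ^+ D = 1.
Proof.
by apply/matrixP => i j; rewrite pauliXXE modnDr modn_small // mxE.
Qed.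

Lemma pauliZ_order : Z ^+ D = 1.
Proof.
rewrite pauliZXE; apply/matrixP => i j; rewrite !mxE mulnC exprM.
by rewrite (prim_expr_order wP) expr1n.
Qed.

Lemma pauliZX_comm (b a : nat) : Z ^+ b *m X ^+ a = w ^+ (b * a) *: (X ^+ a *m Z ^+ b).
Proof.
rewrite pauliZXE mul_diag_mx mul_mx_diag; apply/matrixP => i j.
rewrite !mxE pauliXXE; case: eqP => [->|_]; last by rewrite mulr0 mul0r mulr0.
by rewrite mulr1 mul1r -exprD exprM (prim_expr_mod wP) -exprM mulnDl addnC (mulnC a).
Qed.

Lemma tensorM (A B : 'I_n -> 'M[C]_D) :
  tensor A *m tensor B = tensor (fun k => A k *m B k).
Proof.
apply/matrixP => i j; rewrite !mxE.
under [RHS]eq_bigr do rewrite mxE.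
(* The product over sites of sums over ['I_D] expands into a sum over words, which number the basis
   through [enum_val]. *)
rewrite bigA_distr_bigA [RHS](reindex_onto enum_val enum_rank) /= => [|x _]; last exact: enum_rankK.
apply: eq_big => [l|l _]; first by rewrite enum_valK eqxx.
by rewrite !mxE -big_split.
Qed.

Lemma tensor1 : tensor (fun _ : 'I_n => 1 : 'M[C]_D) = 1.
Proof.
apply/matrixP => i j; rewrite !mxE.
have [->|ne_ij] := eqVneq i j; first by rewrite big1 // => k _; rewrite mxE eqxx.
have /existsP[k ne_k] : [exists k, (enum_val i : {ffun 'I_n -> 'I_D}) k
    != (enum_val j : {ffun 'I_n -> 'I_D}) k].
  apply: contraR ne_ij; rewrite negb_exists => /forallP eq_ij.
  by apply/eqP/enum_val_inj/ffunP => k; apply/eqP; rewrite -[_ == _]negbK.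
by rewrite (bigD1 k) //= mxE (negbTE ne_k) mul0r.
Qed.

Lemma tensorZ (c : 'I_n -> C) (A : 'I_n -> 'M[C]_D) :
  tensor (fun k => c k *: A k) = (\prod_k c k) *: tensor A.
Proof.
apply/matrixP => i j; rewrite !mxE -big_split.
by apply: eq_bigr => k _; rewrite mxE.
Qed.

Lemma eq_tensor (A B : 'I_n -> 'M[C]_D) : A =1 B -> tensor A = tensor B.
Proof. by move=> eqAB; rewrite (_ : A = B) //; apply: funext. Qed.

(** The exponents are unreduced naturals, so that products merely add them; [weyl_pauli] reduces
    them modulo [D]. *)
Definition weyl (a b : 'I_n -> nat) : 'M[C]_(hdim D n) :=
  tensor (fun k => X ^+ a k *m Z ^+ b k).

(** At site [k], moving Z^(b k) past X^(a' k) costs the phase w^(b k * a' k); these phases multiply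
    over the sites. *)
Lemma weylM a b a' b' :
  weyl a b *m weyl a' b' = w ^+ (\sum_k b k * a' k)%N *:
    weyl (fun k => a k + a' k)%N (fun k => b k + b' k)%N.
Proof.
rewrite tensorM (@eq_tensor _ (fun k => w ^+ (b k * a' k)%N *:
   (X ^+ (a k + a' k)%N *m Z ^+ (b k + b' k)%N))).
  by rewrite tensorZ prodrXr.
move=> k; rewrite !exprD -!mulmxE mulmxA -(mulmxA _ (Z ^+ b k)) pauliZX_comm.
by rewrite -scalemxAr -scalemxAl !mulmxA.
Qed.

Lemma weylX a b j : exists l,
  weyl a b ^+ j = w ^+ l *: weyl (fun k => j * a k)%N (fun k => j * b k)%N.
Proof.
elim: j => [|j [l IHj]].
  exists 0%N; rewrite expr0 scale1r -tensor1; apply: eq_tensor => k.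
  by rewrite !mul0n !expr0 mulmx1.
eexists; rewrite exprS IHj -mulmxE -scalemxAr weylM scalerA -exprD.
by congr (_ *: _); apply: eq_tensor.
Qed.

Lemma weyl_order a b : weyl (fun k => D * a k)%N (fun k => D * b k)%N = 1.
Proof.
rewrite -tensor1; apply: eq_tensor => k.
by rewrite !exprM pauliX_order pauliZ_order !expr1n mulmx1.
Qed.

Lemma pauli_weyl (M : 'M[C]_(hdim D n)) :
  pauli M -> exists l a b, M = w ^+ l *: weyl a b.
Proof.
case=> A /choice[l /choice[a /choice[b eqA]]] ->.
exists (\sum_k l k)%N, (fun k => a k : nat), (fun k => b k : nat).
by rewrite (eq_tensor _ _ eqA) tensorZ prodrXr.
Qed.

Hypothesis n0 : (0 < n)%N.

(** In [pauli] phases belong to single sites. Site 0, which exists as n > 0, carries the whole phase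
    and the other sites carry 1. *)
Lemma weyl_pauli l a b : pauli (w ^+ l *: weyl a b).
Proof.
pose k0 := Ordinal n0; pose rem k := Ordinal (ltn_pmod k (prime_gt0 pD)).
exists (fun k => w ^+ rem (if k == k0 then l else 0%N) *: (X ^+ rem (a k) *m Z ^+ rem (b k))).
  by move=> k; do 3 eexists.
rewrite tensorZ; congr (_ *: _).
  rewrite (bigD1 k0) //= ?eqxx (prim_expr_mod wP) big1 ?mulr1 // => k /negbTE ->.
  by rewrite mod0n.
by apply: eq_tensor => k /=; rewrite !expr_mod ?pauliX_order ?pauliZ_order.
Qed.

Lemma pauliM (M N : 'M[C]_(hdim D n)) : pauli M -> pauli N -> pauli (M *m N).
Proof.
move=> /pauli_weyl[l [a [b ->]]] /pauli_weyl[l' [a' [b' ->]]].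
rewrite -scalemxAr -scalemxAl weylM !scalerA -!exprD; exact: weyl_pauli.
Qed.

Lemma pauli_scale (M : 'M[C]_(hdim D n)) k : pauli M -> pauli (w ^+ k *: M).
Proof.
move=> /pauli_weyl[l [a [b ->]]]; rewrite scalerA -exprD; exact: weyl_pauli.
Qed.

(** Exponents add in either order, so both products are phases times the same Weyl operator. *)
Lemma pauli_comm (M N : 'M[C]_(hdim D n)) :
  pauli M -> pauli N -> exists c, M *m N = w ^+ c *: (N *m M).
Proof.
move=> /pauli_weyl[l [a [b ->]]] /pauli_weyl[l' [a' [b' ->]]].
have [c cE] := omega_inv (\sum_k b' k * a k).
exists ((\sum_k b k * a' k) + c)%N; rewrite -!scalemxAr -!scalemxAl !weylM !scalerA.
rewrite (_ : weyl (fun k => a' k + a k)%N (fun k => b' k + b k)%N =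
             weyl (fun k => a k + a' k)%N (fun k => b k + b' k)%N); last first.
  by apply: eq_tensor => k; rewrite addnC [(b' k + _)%N]addnC.
rewrite exprD -cE; congr (_ *: _); field.
by rewrite expf_neq0 ?omega_neq0.
Qed.

(** The Weyl operator with exponents multiplied by [D] is 1, and the D-th power of w^l is 1; only
    the phase from reordering survives. *)
Lemma pauli_order (M : 'M[C]_(hdim D n)) :
  pauli M -> exists a : 'I_D, M ^+ D = (w ^+ a)%:M.
Proof.
move=> /pauli_weyl[l [a [b ->]]].
have [l' eqX] := weylX a b D.
exists (Ordinal (ltn_pmod l' (prime_gt0 pD))).
rewrite expr_scalemx eqX weyl_order -exprM mulnC exprM (prim_expr_order wP) expr1n scale1r.
by rewrite /= (prim_expr_mod wP) -scalemx1.
Qed.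

End WeylOperators.

(** * Generated groups, their codes, and elements of finite order *)

Lemma subgroupX (R : realType) (D n : nat) (S : set 'M[R[i]]_(hdim D n)) s k :
  is_subgroup S -> S s -> S (s ^+ k).
Proof.
case=> S1 SM _ Ss; elim: k => [|k IHk]; first exact: S1.
by rewrite exprS; apply: SM.
Qed.

Lemma generated_subgroup (R : realType) (D n : nat)
  (A : set 'M[R[i]]_(hdim D n)) : is_subgroup (generated A).
Proof.
split=> [B [[B1 _ _] _] //|s t As At B BA|s As B BA].
  by case: (BA) => -[_ BM _] _; apply: BM; [apply: As|apply: At].
by case: (BA) => -[_ _ BV] _; apply: BV; apply: As.
Qed.

(** The matrices fixing [psi] form a subgroup, so it is enough to fix the generators. *)
Lemma code_generated (R : realType) (D n : nat) (A : set 'M[R[i]]_(hdim D n)) psi :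
  Defs.code (generated A) psi <-> forall s, A s -> s *m psi = psi.
Proof.
split=> [cA s As|fixA]; first by apply: cA; apply: sub_gen_smallest.
suff sub : generated A `<=` [set s | s *m psi = psi] by move=> s /sub.
apply: smallest_sub => //; split=> [|s t /= fs ft|s /= fs] /=; first exact: mul1mx.
  by rewrite -mulmxA ft.
(* On a singular matrix [invmx] returns its argument, which fixes [psi]. *)
have [su|su] := boolP (s \in unitmx); last by rewrite /invmx (negbTE su).
by rewrite -[X in _ *m X = _]fs mulKmx.
Qed.

Lemma invmx_expr (F : comUnitRingType) (N m : nat) (M : 'M[F]_N) :
  M ^+ m.+1 = 1 -> invmx M = M ^+ m.
Proof.
move=> Mm; have MM : M ^+ m *m M = 1%:M by rewrite mulmxE -exprSr.
have [_ Mu] := mulmx1_unit MM.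
by rewrite -[RHS](mulmxK Mu) MM mul1mx.
Qed.

(** The power s^D is a scalar power of [omega] lying in [S], which contains no such scalar but 1. *)
Lemma stabilizer_order (R : realType) (D n : nat) (S : set 'M[R[i]]_(hdim D n)) s :
  prime D -> stabilizer_group S -> S s -> s ^+ D = 1.
Proof.
move=> pD [Sp Sg _ Sw] Ss; have [a sD] := pauli_order R D n pD _ (Sp _ Ss).
have a0 : a = 0%N :> nat by apply: Sw; rewrite -sD; apply: subgroupX.
by rewrite sD a0.
Qed.

Lemma scalar_mx_expr (F : comPzRingType) (N k : nat) (c : F) :
  (c%:M : 'M[F]_N) ^+ k = (c ^+ k)%:M.
Proof. by rewrite -(scalemx1 _ c) expr_scalemx expr1n -[RHS]scalemx1. Qed.

(** Multiplication shifts the powers cyclically. This serves both the projector, with powers of [Q],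
    and the sum of the powers of a stabilizer. *)
Lemma sum_expr_mulr (F : comPzRingType) (N m : nat) (M : 'M[F]_N) :
  (0 < m)%N -> M ^+ m = 1 -> (\sum_(j < m) M ^+ j) *m M = \sum_(j < m) M ^+ j.
Proof.
case: m => // m _ Mm; rewrite mulmx_suml.
under eq_bigr do rewrite mulmxE -exprSr.
by rewrite big_ord_recr big_ord_recl /= Mm addrC.
Qed.

Lemma modn_inverse (p k : nat) :
  prime p -> ~~ (p %| k)%N -> exists u, u * k = 1 %[mod p].
Proof.
move=> pp; have [->|k0 npk] := posnP k; first by rewrite dvdn0.
have [u v uE _] := egcdnP p k0; exists u; rewrite uE modnMDl.
by rewrite (eqP (_ : coprime k p)) // coprime_sym prime_coprime.
Qed.

(** * The measurement projector and post-measurement states *)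

Section Measurement.
Variables (R : realType) (D n : nat).
Hypotheses (pD : prime D) (n0 : (0 < n)%N).
Local Notation C := (R[i]).
Local Notation w := (omega R D).
Local Notation oper := 'M[C]_(hdim D n).
Local Notation vec := 'cV[C]_(hdim D n).
Variables (P : oper) (o : 'I_D).
Hypothesis PD : P ^+ D = 1.
Local Notation Q := (w ^- o *: P).
Local Notation Pi := (meas_proj P o).

Let wP : D.-primitive_root w. Proof. exact: omega_prim. Qed.

Lemma shifted_order : Q ^+ D = 1.
Proof.
rewrite expr_scalemx PD exprVn -exprM mulnC exprM (prim_expr_order wP).
by rewrite expr1n invr1 scale1r.
Qed.

Lemma meas_projMr : Pi *m Q = Pi.
Proof. by rewrite /meas_proj -scalemxAl sum_expr_mulr ?prime_gt0 ?shifted_order.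
Qed.

Lemma meas_proj_comm (s : oper) : P *m s = s *m P -> Pi *m s = s *m Pi.
Proof.
move=> Ps; have Qs : GRing.comm s Q.
  by rewrite /GRing.comm -!mulmxE -scalemxAl -scalemxAr Ps.
rewrite /meas_proj -scalemxAl -scalemxAr mulmx_suml mulmx_sumr; congr (_ *: _).
by apply: eq_bigr => j _; rewrite mulmxE [RHS](commrX j Qs).
Qed.

Lemma meas_projMl : Q *m Pi = Pi.
Proof. by rewrite -scalemxAl -meas_proj_comm // scalemxAr meas_projMr. Qed.

Lemma meas_proj_fixed (v : vec) : Q *m v = v -> Pi *m v = v.
Proof.
move=> Qv; rewrite /meas_proj -scalemxAl mulmx_suml.
rewrite (eq_bigr (fun=> v)) => [|j _].
  rewrite sumr_const card_ord -(scaler_nat _ v) scalerA mulVf ?scale1r //.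
  by rewrite pnatr_eq0 -lt0n prime_gt0.
elim: (nat_of_ord j) => [|k IHk]; first by rewrite expr0 mul1mx.
by rewrite exprSr -mulmxE -mulmxA Qv.
Qed.

(** The projector absorbs [Q], so Pi v = Pi Q v = z Pi v. *)
Lemma meas_proj_eigen (v : vec) z : Q *m v = z *: v -> z != 1 -> Pi *m v = 0.
Proof.
move=> Qv z1; have : (1 - z) *: (Pi *m v) = 0.
  by rewrite scalerBl scale1r scalemxAr -Qv mulmxA meas_projMr subrr.
by move/eqP; rewrite scaler_eq0 subr_eq0 eq_sym (negbTE z1) => /eqP.
Qed.

Lemma sqnormZ c (v : vec) : sqnorm (c *: v) = `|c| ^+ 2 * sqnorm v.
Proof.
rewrite /sqnorm mulr_sumr; apply: eq_bigr => k _.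
by rewrite mxE normrM exprMn.
Qed.

Lemma sqnorm_ge0 (v : vec) : 0 <= sqnorm v.
Proof. by apply: sumr_ge0 => k _; rewrite exprn_ge0. Qed.

Lemma sqnorm_eq0 (v : vec) : (sqnorm v == 0) = (v == 0).
Proof.
apply/eqP/eqP => [v0|->]; last first.
  by rewrite /sqnorm big1 // => k _; rewrite mxE normr0 expr0n.
apply/colP => k; rewrite mxE; apply/eqP.
have /psumr_eq0P/(_ v0) := fun j (_ : true) => exprn_ge0 2 (normr_ge0 (v j 0)).
by move/(_ k isT)/eqP; rewrite expf_eq0 normr_eq0.
Qed.

Lemma post_state_fixed (phi : vec) :
  state phi -> Q *m phi = phi -> post_state P o phi phi.
Proof.
move=> sphi Qphi; rewrite /post_state /outcome_prob meas_proj_fixed // sphi.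
by rewrite oner_eq0 sqrtC1 invr1 scale1r.
Qed.

Lemma post_state_eigen (psi phi : vec) : post_state P o psi phi -> Q *m phi = phi.
Proof. by case=> _ ->; rewrite -scalemxAr mulmxA meas_projMl. Qed.

Lemma post_state_comm (s : oper) (psi phi : vec) :
  P *m s = s *m P -> s *m psi = psi -> post_state P o psi phi -> s *m phi = phi.
Proof.
move=> Ps fs [_ ->].
by rewrite -scalemxAr mulmxA -(meas_proj_comm _ Ps) -mulmxA fs.
Qed.

(** Normalization divides by [|t|]; it gives back [phi] itself, without a phase, because [t] is
    positive. *)
Lemma post_state_normalize (t : C) (psi phi : vec) :
  0 < t -> state phi -> Pi *m psi = t *: phi -> post_state P o psi phi.
Proof.
move=> t0 sphi Ppsi; rewrite /post_state /outcome_prob Ppsi sqnormZ sphi mulr1.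
rewrite gtr0_norm // sqrCK ?ltW //; split; first by rewrite gt_eqF ?exprn_gt0.
by rewrite scalerA mulVf ?scale1r // gt_eqF.
Qed.

(** * Updating the stabilizer group *)

Variable S : set oper.
Hypotheses (hS : stabilizer_group S) (pP : pauli P).

Let SX s k : S s -> S (s ^+ k).
Proof. by apply: subgroupX; case: hS. Qed.

(** Serves both rules that add [Q]: [A] is a generating set of [S] when [P] commutes with [S], and
    otherwise a set of stabilizers commuting with [P]. *)
Lemma stabilizer_group_extend (A : set oper) :
    (forall a : 'I_D, ~ S (w ^+ a *: P)) -> A `<=` S ->
    (forall s, A s -> P *m s = s *m P) ->
  stabilizer_group (generated ([set Q] `|` A)).
Proof.
move=> PnS AS PA; have [Sp [S1 SM SV] SC Sw] := hS.
(* [E] may exceed the generated group; containing it is enough, since the remaining properties pass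
   to subgroups. *)
pose E : set oper := [set x | exists k s, [/\ S s, P *m s = s *m P & x = Q ^+ k *m s]].
have Qcomm s k : P *m s = s *m P -> GRing.comm (Q ^+ k) s.
  move=> Ps; apply/commr_sym/commrX.
  by rewrite /GRing.comm -!mulmxE -scalemxAl -scalemxAr Ps.
have E_order x : E x -> x ^+ D = 1.
  case=> k [s [Ss Ps ->]]; rewrite mulmxE (exprMn_comm D (Qcomm _ k Ps)).
  rewrite (stabilizer_order R D n S s pD hS Ss) -exprM mulnC exprM shifted_order.
  by rewrite expr1n mulr1.
have EM x y : E x -> E y -> E (x *m y).
  move=> [k [s [Ss Ps ->]]] [l [t [St Pt ->]]]; exists (k + l)%N, (s *m t).
  split; first exact: SM.
    by rewrite mulmxA Ps -mulmxA Pt mulmxA.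
  by rewrite exprD !mulmxE -!mulrA; congr (_ * _); rewrite !mulrA (Qcomm _ l Ps).
have E1 : E 1%:M by exists 0%N, 1; split; rewrite ?mulmx1 ?mul1mx.
have EX x k : E x -> E (x ^+ k).
  by move=> Ex; elim: k => [|k IHk]; [exact: E1|rewrite exprS; apply: EM].
have E_subgroup : is_subgroup E.
  split=> // x Ex; rewrite (@invmx_expr _ _ D.-1) ?prednK ?prime_gt0 //; first exact: EX.
  exact: E_order.
have genE : generated ([set Q] `|` A) `<=` E.
  apply: smallest_sub => // x [->|Ax].
    by exists 1%N, 1; split; rewrite ?mulmx1 ?mul1mx ?expr1.
  by exists 0%N, x; split; [exact: AS|exact: PA|rewrite mul1mx].
split; last 1 first.
- move=> a /genE[k [s [Ss Ps eqw]]]; have [Dk|nDk] := boolP (D %| k)%N.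
    apply: Sw; rewrite eqw; have /dvdnP[l ->] := Dk.
    by rewrite mulnC exprM shifted_order expr1n mul1mx.
  (* If [D] does not divide [k], raising the scalar Q^k s to the inverse [u] of [k] isolates [Q]: it
     is a phase times the inverse of s^u. Hence a multiple of [P] by a phase lies in [S], a
     contradiction. *)
  have [u uk] := modn_inverse _ _ pD nDk.
  have Qs : Q *m s ^+ u = w ^+ (a * u) *: 1%:M.
    rewrite scalemx1 exprM -scalar_mx_expr eqw.
    rewrite mulmxE (exprMn_comm _ (Qcomm _ _ Ps)) -exprM.
    by rewrite -(expr_mod (k * u) shifted_order) [(k * u)%N]mulnC uk expr_mod ?shifted_order.
  have [c cE] := omega_inv R D pD (o + a * u); case: (PnS c).
  suff -> : w ^+ c *: P = s ^+ (u * D.-1) by apply: SX.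
  have sDu : s ^+ u *m s ^+ (u * D.-1) = 1%:M.
    rewrite mulmxE -exprD -mulnS prednK ?prime_gt0 // mulnC exprM.
    by rewrite (stabilizer_order R D n S s pD hS Ss) expr1n.
  rewrite -cE exprD invfM mulrC -scalerA -[Q]mulmx1 -sDu mulmxA Qs -scalemxAl.
  by rewrite mul1mx scalerA mulVf ?scale1r // expf_neq0 ?omega_neq0.
- move=> x /genE[k [s [Ss Ps ->]]].
  (* A natural power replaces w^-o, so that [pauli_scale] applies. *)
  have [b wb] := omega_inv R D pD o.
  rewrite expr_scalemx wb -exprM -scalemxAl; apply: pauli_scale => //.
  elim: k => [|k IHk]; first by rewrite mul1mx; apply: Sp.
  by rewrite exprS -mulmxE -mulmxA; apply: pauliM.
- exact: generated_subgroup.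
move=> x y /genE[k [s [Ss Ps ->]]] /genE[l [t [St Pt ->]]].
have QQ : GRing.comm (Q ^+ k) (Q ^+ l) by apply/commrX/commr_sym/commrX.
have st : GRing.comm s t by apply: SC.
apply: commrM; apply/commr_sym/commrM; last exact: commr_sym.
- exact: commr_sym.
- exact: Qcomm.
exact/commr_sym/Qcomm.
Qed.
Lemma code_extend (A : set oper) (phi : vec) :
  Defs.code (generated ([set Q] `|` A)) phi <->
  Q *m phi = phi /\ forall s, A s -> s *m phi = phi.
Proof.
rewrite code_generated; split=> [fixQA|[fixQ fixA] s [->|/fixA] //].
by split=> [|s As]; apply: fixQA; [left|right].
Qed.

Lemma updated_commuting (A : set oper) :
    S = generated A -> (forall a : 'I_D, ~ S (w ^+ a *: P)) ->
    (forall s, S s -> P *m s = s *m P) ->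
  updated S P o (generated ([set Q] `|` A)).
Proof.
move=> SA PnS PS; have AS : A `<=` S by rewrite SA; apply: sub_gen_smallest.
split=> [|_ phi sphi]; first by apply: stabilizer_group_extend => // s /AS /PS.
rewrite code_extend; split=> [[fixQ fixA]|[psi [spsi cpsi post]]].
  exists phi; split=> //; last exact: post_state_fixed.
  by rewrite SA; apply/code_generated.
split=> [|s /AS Ss]; first exact: post_state_eigen post.
by apply: post_state_comm post; [exact: PS|exact: cpsi].
Qed.

Lemma omega_commX c (g : oper) k :
  P *m g = w ^+ c *: (g *m P) -> P *m g ^+ k = w ^+ (c * k) *: (g ^+ k *m P).
Proof.
move=> Pg; elim: k => [|k IHk]; first by rewrite muln0 scale1r mulmx1 mul1mx.
rewrite !exprSr -!mulmxE mulmxA IHk -scalemxAl -!mulmxA Pg -scalemxAr scalerA.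
by rewrite -exprD mulnS addnC.
Qed.

Lemma updated_noncommuting (g : oper) (A : set oper) :
    S = generated ([set g] `|` A) -> P *m g != g *m P ->
    (forall s, A s -> P *m s = s *m P) ->
  updated S P o (generated ([set Q] `|` A)).
Proof.
move=> SgA Pg PA; have [Sp _ SC _] := hS.
have Sg : S g by rewrite SgA; apply: sub_gen_smallest; left.
have AS : A `<=` S by rewrite SgA => s As; apply: sub_gen_smallest; right.
split=> [|_ phi sphi].
  (* A multiple w^a P in the abelian group [S] would commute with [g], and then so would [P]. *)
  apply: stabilizer_group_extend => // a /SC/(_ Sg)/eqP.
  rewrite -scalemxAl -scalemxAr (inj_eq (scalerI _)) ?(negbTE Pg) //.
  by rewrite expf_neq0 ?omega_neq0.
rewrite code_extend; split=> [[fixQ fixA]|[psi [spsi cpsi post]]]; last first.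
  split=> [|s As]; first exact: post_state_eigen post.
  by apply: post_state_comm post; [exact: PA|exact/cpsi/AS].
have [c Pgc] := pauli_comm R D n pD P g pP (Sp _ Sg).
have nDc : ~~ (D %| c)%N.
  by rewrite (prim_order_dvd wP); apply: contra Pg => /eqP wc; rewrite Pgc wc scale1r.
pose T : oper := \sum_(j < D) g ^+ j; pose v := T *m phi.
have TC s : S s -> s *m T = T *m s.
  move=> Ss; rewrite /T mulmx_sumr mulmx_suml; apply: eq_bigr => j _.
  by apply: commrX; apply: SC.
have cv : Defs.code S v.
  rewrite SgA code_generated => s [->|As]; rewrite /v mulmxA TC //; last exact: AS.
    by rewrite sum_expr_mulr ?prime_gt0 // (stabilizer_order R D n S).
  by rewrite -mulmxA fixA.
have Pv : Pi *m v = phi.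
  rewrite /v /T mulmx_suml mulmx_sumr (bigD1 (Ordinal (prime_gt0 pD))) //=.
  rewrite expr0 mul1mx meas_proj_fixed // big1 ?addr0 // => j j0.
  (* Moving [Q] past g^j costs w^(c j), and [Q] fixes [phi]. *)
  apply: (@meas_proj_eigen _ (w ^+ (c * j))).
    rewrite mulmxA -scalemxAl (omega_commX _ _ _ Pgc) scalerA mulrC -scalerA.
    by rewrite -scalemxAl (scalemxAr (w ^- o)) -mulmxA fixQ.
  (* The eigenvalue is not 1: the prime [D] divides neither [c] nor [j], as 0 < j < D. *)
  rewrite -(prim_order_dvd wP) Euclid_dvdM // negb_or nDc /=.
  by rewrite gtnNdvd // lt0n.
(* [v] is nonzero because its projection is the unit vector [phi]. *)
have v0 : 0 < sqnorm v.
  rewrite lt_neqAle eq_sym sqnorm_eq0 sqnorm_ge0 andbT.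
  apply: contraTneq isT => v0; move: sphi; rewrite -Pv v0 mulmx0 /state.
  by move/eqP; rewrite eq_sym (_ : sqnorm 0 = 0) ?oner_eq0 //; apply/eqP; rewrite sqnorm_eq0.
pose t := (sqrtC (sqnorm v))^-1.
have t0 : 0 < t by rewrite invr_gt0 sqrtC_gt0.
exists (t *: v); split.
- by rewrite /state sqnormZ gtr0_norm // exprVn sqrtCK mulVf ?gt_eqF.
- by move=> s Ss; rewrite -scalemxAr cv.
by apply: (@post_state_normalize t); rewrite // -scalemxAr Pv.
Qed.

Lemma exists_commuting_multiple (h g : oper) :
    S h -> P *m h != h *m P -> S g ->
  exists g', [/\ S g', P *m g' = g' *m P & exists k, g = g' *m h ^+ k].
Proof.
move=> Sh Ph Sg; have [Sp [_ SM _] _ _] := hS.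
have [c Phc] := pauli_comm R D n pD P h pP (Sp _ Sh).
have [d Pgd] := pauli_comm R D n pD P g pP (Sp _ Sg).
have [u uc] : exists u, u * c = 1 %[mod D].
  apply: modn_inverse => //; rewrite (prim_order_dvd wP).
  by apply: contra Ph => /eqP wc; rewrite Phc wc scale1r.
(* This is -d / c modulo [D], so the phases w^d of [g] and w^(c k) of h^k cancel. *)
pose k := (u * (D.-1 * d))%N; exists (g *m h ^+ k); split.
- by apply: SM => //; apply: SX.
- rewrite mulmxA Pgd -scalemxAl -mulmxA (omega_commX _ _ _ Phc) -scalemxAr scalerA.
  rewrite -exprD -(prim_expr_mod wP) /k mulnA [(c * u)%N]mulnC.
  rewrite -modnDmr -modnMml uc modnMml modnDmr mul1n -mulSn prednK ?prime_gt0 //.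
  by rewrite modnMr scale1r mulmxA.
(* As h^D = 1, this power of [h] inverts h^k. *)
exists (k * D.-1)%N; rewrite -mulmxA mulmxE -exprD -mulnS prednK ?prime_gt0 //.
by rewrite mulnC exprM (stabilizer_order R D n S h pD hS Sh) expr1n mulr1.
Qed.

End Measurement.

(** On the code [P] acts as the scalar w^-a, so every code state is an eigenvector with the same
    outcome. *)
Lemma updated_contained (R : realType) (D n : nat) (S : set 'M[R[i]]_(hdim D n))
    (P : 'M[R[i]]_(hdim D n)) (o a : 'I_D) :
    prime D -> P ^+ D = 1 -> stabilizer_group S -> S (omega R D ^+ a *: P) ->
  updated S P o S /\ deterministic S P.
Proof.
move=> pD PD hS SP; set w := omega R D in SP *; have wP := omega_prim R D pD.
have [Sp _ SC _] := hS.
have wX0 k : w ^+ k != 0 by rewrite expf_neq0 ?omega_neq0.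
have PS s : S s -> P *m s = s *m P.
  move=> Ss; have := SC _ _ SP Ss; rewrite -scalemxAl -scalemxAr.
  by apply: scalerI.
have [b wb] := omega_inv R D pD a.
split; last first.
  exists b => psi spsi cpsi; rewrite /outcome_prob meas_proj_fixed //.
  by rewrite -wb invrK cpsi.
split=> // -[psi0 [spsi0 cpsi0 prob0]] phi sphi.
have Qeigen psi : Defs.code S psi ->
    (w ^- o *: P) *m psi = (w ^- o * w ^- a) *: psi.
  move=> cpsi; rewrite -{2}(cpsi _ SP) -!scalemxAl scalerA.
  by rewrite -mulrA mulVf ?mulr1.
(* Otherwise the projector would kill [psi0], whose outcome probability is nonzero. *)
have oa : w ^- o * w ^- a = 1.
  apply: contraNeq prob0 => /(meas_proj_eigen _ _ _ pD _ _ PD _ _ (Qeigen _ cpsi0)).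
  by rewrite /outcome_prob => ->; rewrite sqnorm_eq0.
split=> [cphi|[psi [spsi cpsi post]] s Ss].
  by exists phi; split=> //; apply: post_state_fixed => //; rewrite Qeigen // oa scale1r.
by apply: post_state_comm post; [exact: PS|exact: cpsi].
Qed.

(** * The three update rules, with the explicit replacement of generators *)

Theorem theorem1 (R : realType) (D n : nat) (hD : prime D) (hn : (0 < n)%N)
    (G : seq 'M[R[i]]_(hdim D n)) (S : set 'M[R[i]]_(hdim D n))
    (hS : stabilizer_group S) (hG : S = generated [set` G])
    (P : 'M[R[i]]_(hdim D n)) (hP : pauli P) (hPD : P ^+ D = 1)
    (o : 'I_D) :
  let W := [seq g <- G | P *m g != g *m P] in
  let K := [seq g <- G | P *m g == g *m P] in
  [/\ (exists a : 'I_D, S (omega R D ^+ a *: P)) ->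
        updated S P o S /\ deterministic S P,
      (forall a : 'I_D, ~ S (omega R D ^+ a *: P)) ->
      (forall s, S s -> P *m s = s *m P) ->
        updated S P o (generated ([set omega R D ^- o *: P] `|` [set` G]))
    & forall gstar, gstar \in W ->
        exists W' : seq 'M[R[i]]_(hdim D n),
          [/\ size W' = (size W).-1,
              [set` W'] `<=` S,
              S = generated ([set` W'] `|` [set gstar] `|` [set` K])
            & updated S P o
                (generated ([set` W'] `|` [set omega R D ^- o *: P]
                            `|` [set` K]))]].
Proof.
move=> W K; have [_ Sg _ _] := hS.
have GS g : g \in G -> S g by move=> gG; rewrite hG; apply: sub_gen_smallest.
split=> [[a SP]|PnS PS|h hW]; first exact: updated_contained SP.
  exact: updated_commuting.
have [Ph hGin] : P *m h != h *m P /\ h \in G by move: hW; rewrite mem_filter => /andP.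
have Sh := GS _ hGin.
(* [f] multiplies a stabilizer by a power of [h] to make it commute with [P]; outside [S] its value
   is irrelevant. *)
have /choice[f fP] g : exists g', S g ->
    [/\ S g', P *m g' = g' *m P & exists k, g = g' *m h ^+ k].
  have [Sgg|nSg] := pselect (S g); last by exists g.
  have [g' g'P] := exists_commuting_multiple R D n hD P S hS hP h g Sh Ph Sgg.
  by exists g'.
have remG g : g \in rem h W -> S g.
  by move=> /mem_rem; rewrite mem_filter => /andP[_ /GS].
(* Only one occurrence of [h] is removed, which gives the size l - 1 even if the list repeats
   [h]. *)
pose W' := map f (rem h W).
have W'S g : g \in W' -> S g by move=> /mapP[g0 /remG /fP[Sf _ _] ->].
have KS g : g \in K -> S g by rewrite mem_filter => /andP[_ /GS].
have SE : S = generated ([set` W'] `|` [set h] `|` [set` K]).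
  apply/seteqP; split; last first.
    by apply: smallest_sub => // g [[/W'S|->]|/KS].
  rewrite {1}hG; set B := _ `|` _ `|` _.
  have gB := generated_subgroup _ _ _ B; have [_ BM _] := gB.
  have BB : B `<=` generated B by apply: sub_gen_smallest.
  apply: smallest_sub => // g /= gG.
  have [Pg|Pg] := boolP (P *m g == g *m P).
    by apply: BB; right; rewrite /= mem_filter Pg.
  have [->|gh] := eqVneq g h; first by apply: BB; left; right.
  have gW : g \in rem h W.
    have : g \in W by rewrite mem_filter Pg.
    by rewrite (perm_mem (perm_to_rem hW)) inE (negbTE gh).
  (* The old generator is recovered as its replacement times a power of [h]. *)
  have [_ _ [k ->]] := fP _ (remG _ gW).
  apply: BM; first by apply: BB; left; left; apply: map_f.
  by apply: (subgroupX _ _ _ _ _ _ gB); apply: BB; left; right.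
exists W'; split=> //; first by rewrite size_map size_rem.
rewrite setUAC setUC; apply: (updated_noncommuting _ _ _ _ _ _ _ _ _ _ _ h) => //.
  by rewrite SE setUAC setUC.
move=> s [/mapP[g0 /remG /fP[_ Pf _] ->] //|/=].
by rewrite mem_filter => /andP[/eqP].
Qed.
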